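(* Let $T\ge 1$ be an integer, let $d_x,d_y\ge 1$, let $z_0=(x_0,y_0)\in\mathbb{R}^{d_x}\times\mathbb{R}^{d_y}$, and let $0<m\le M<\infty$ with $\kappa:=M/m$. Consider any bilinear min-max problem $$\min_{x\in\mathbb{R}^{d_x}}\max_{y\in\mathbb{R}^{d_y}}\ (x-\tilde x)^\top\mathbf{B}(y-\tilde y),$$ where $\tilde x\in\mathbb{R}^{d_x}$, $\tilde y\in\mathbb{R}^{d_y}$, and $\mathbf{B}\in\mathbb{R}^{d_x\times d_y}$ is such that all non-zero squared singular values of $\mathbf{B}$ lie in $[m,M]$. Run GDA from $z_0$ for $2T$ iterations using the slingshot stepsize schedule for bilinear problems (defined in the context). Then GDA converges to a saddle point at the following rate: there is a saddle point $z^*$ of the problem such that $$\|z_{2T}-z^*\|\le R_T\,\|z_0-z^*\|,\qquad R_T:=\frac{2(\sqrt\kappa+1)^T(\sqrt\kappa-1)^T}{(\sqrt\kappa+1)^{2T}+(\sqrt\kappa-1)^{2T}}.$$ In particular, $\|z_{2T}-z^*\|\le\varepsilon$ after $O\!\left(\sqrt\kappa\,\log\frac{\|z_0-z^*\|}{\varepsilon}\right)$ iterations.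
   Context: For a differentiable $f(x,y)$, GDA with stepsizes $\alpha_t,\beta_t\in\mathbb{R}$ is the iteration $x_{t+1}=x_t-\alpha_t\nabla_x f(x_t,y_t)$, $y_{t+1}=y_t+\beta_t\nabla_y f(x_t,y_t)$; write $z_t=(x_t,y_t)$, and $\|\cdot\|$ is the Euclidean norm. A saddle point is a point $z^*=(x^*,y^* )$ with $f(x^*,y)\le f(x^*,y^* )\le f(x,y^* )$ for all $x,y$. Slingshot stepsize schedule for bilinear problems (for $2T$ iterations and spectral bounds $0<m\le M$): let $$r_t:=\frac{M+m}{2}+\frac{M-m}{2}\cos\!\left(\frac{2t+1}{2T}\pi\right),\qquad t\in\{0,1,\dots,T-1\},$$ let $\{h_t\}_{t=0}^{T-1}$ be any permutation of $\{r_t^{-1/2}\}_{t=0}^{T-1}$, and set $$\alpha_{2t}=-\beta_{2t}=-\alpha_{2t+1}=\beta_{2t+1}=h_t,\qquad t\in\{0,1,\dots,T-1\}.$$ The schedule depends on the total number of iterations $2T$. In the $O(\cdot)$ statement, the constant is universal and $\varepsilon$ is a target accuracy bounded away from the initial error (e.g. $0<\varepsilon\le\frac12\|z_0-z^*\|$). *)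

(* Defs.v *)
From HB Require Import structures.
From mathcomp Require Import all_boot all_order all_fingroup all_algebra.
From mathcomp Require Import all_classical all_reals all_analysis.

Set Implicit Arguments.
Unset Strict Implicit.
Unset Printing Implicit Defensive.

Import Order.TTheory GRing.Theory Num.Theory.
Import numFieldNormedType.Exports.

Local Open Scope ring_scope.

Section MinMax.
Context {R : realType} {dx dy : nat}.
Local Notation point := ('cV[R]_dx * 'cV[R]_dy)%type.

(* The norms that the library puts on matrices and pairs are sup norms, hence
   this explicit Euclidean norm on R^dx x R^dy. *)
Definition enorm (z : point) : R :=
  Num.sqrt (\sum_i z.1 i 0 ^+ 2 + \sum_j z.2 j 0 ^+ 2).

Definition saddle_point (f : 'cV[R]_dx -> 'cV[R]_dy -> R) (z : point) : Prop :=
  forall x y, f z.1 y <= f z.1 z.2 <= f x z.2.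

Definition gradient n (g : 'cV[R]_n -> R) (x : 'cV[R]_n) : 'cV[R]_n :=
  \col_i 'D_(delta_mx i 0) (g : 'cV[R]_n -> R^o) x.

Fixpoint gda (f : 'cV[R]_dx -> 'cV[R]_dy -> R) (alpha beta : nat -> R)
    (z0 : point) (t : nat) : point :=
  if t is t'.+1 then
    let z := gda f alpha beta z0 t' in
    (z.1 - alpha t' *: gradient (fun x => f x z.2) z.1,
     z.2 + beta t' *: gradient (fun y => f z.1 y) z.2)
  else z0.

Definition bilinear_objective (B : 'M[R]_(dx, dy)) (xt : 'cV[R]_dx)
    (yt : 'cV[R]_dy) (x : 'cV[R]_dx) (y : 'cV[R]_dy) : R :=
  ((x - xt)^T *m B *m (y - yt)) 0 0.

(* When dx < dy, 0 is also counted, although it need not be one of the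
   min(dx, dy) singular values of B; the non-zero ones are the usual ones. *)
Definition singular_value (B : 'M[R]_(dx, dy)) (s : R) : Prop :=
  0 <= s /\ eigenvalue (B^T *m B) (s ^+ 2).

End MinMax.

Section Slingshot.
Context {R : realType}.

Definition chebyshev_node (m M : R) (T t : nat) : R :=
  (M + m) / 2 + (M - m) / 2 * cos ((2 * t + 1)%:R / (2 * T)%:R * pi).

(* Only the stepsizes of iterations 0, ..., 2T - 1 are constrained. *)
Definition slingshot (m M : R) (T : nat) (alpha beta : nat -> R) : Prop :=
  exists s : {perm 'I_T}, forall t : 'I_T,
    let h := (Num.sqrt (chebyshev_node m M T (s t)))^-1 in
    [/\ alpha (2 * t)%N = h, beta (2 * t)%N = - h,
        alpha (2 * t + 1)%N = - h & beta (2 * t + 1)%N = h].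

Definition slingshot_rate (kappa : R) (T : nat) : R :=
  let q := Num.sqrt kappa in
  2 * (q + 1) ^+ T * (q - 1) ^+ T / ((q + 1) ^+ (2 * T) + (q - 1) ^+ (2 * T)).

End Slingshot.

(* Main.v *)
Require Import Defs.
From HB Require Import structures.
From mathcomp Require Import all_boot all_order all_fingroup all_algebra.
From mathcomp Require Import ring lra complex spectral sesquilinear.
From mathcomp Require Import all_classical all_reals all_analysis.

Set Implicit Arguments.
Unset Strict Implicit.
Unset Printing Implicit Defensive.

Import Order.TTheory GRing.Theory Num.Theory.
Import numFieldNormedType.Exports.

Local Open Scope ring_scope.

(** A slingshot pair of iterations moves along the bilinear vector field with
    step [h] for [x] and [-h] for [y], then with the opposite steps.  In the
    centered coordinates [u = x - xt], [v = y - yt] the first-order terms cancel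
    and what remains is [u - h^2 B B^T u] and [v - h^2 B^T B v]
    ([gda_two_steps]): the two players decouple, and each performs gradient
    descent with steps [h^2 = 1 / r_t] on the quadratics [|B^T u|^2 / 2] and
    [|B v|^2 / 2].

    Split [u_0 = u* + B w] with [B^T u* = 0] ([kernel_range_decomposition]), and
    [v_0] likewise.  The kernel parts never move; shifted back by [(xt, yt)],
    they make up the saddle point [zs].  On the range part, [T] steps act as the polynomial
    [p(l) = \prod_t (1 - l / r_t)] of the matrix [B B^T], and the spectral theorem
    turns the error bound into [|p(l)| <= R_T] at the nonzero eigenvalues [l] of
    [B^T B], which all lie in [[m, M]] ([sqnorm_horner_le]).

    Let [m < M]; for [m = M] every [r_t] is [m] and [p] vanishes at [l = m].
    The [r_t] are the zeros of the Chebyshev polynomial [T_T] carried from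
    [[-1, 1]] to [[m, M]], so [p] is [T_T], carried along in the same way, divided
    by its value at the point [x0 = - (M + m) / (M - m)] that corresponds to
    [l = 0].  On [[-1, 1]] the numerator is at most 1 in absolute value; and
    [x0 = - (a + 1 / a) / 2] for [a = (sqrt kappa + 1) / (sqrt kappa - 1)], so the
    denominator is [(a^T + a^-T) / 2] up to sign, which is [1 / R_T]
    ([slingshot_poly_bound]).

    For the iteration count, [R_T <= 2 a^-T <= 2 exp (- T / sqrt kappa)], hence a
    [T] of order [sqrt kappa * log (D / eps)] is enough when the initial distance
    is [D >= 2 eps]. *)

(** * Chebyshev polynomials *)

Section Chebyshev.
Context {R : realType}.
Implicit Types (x z : R) (n : nat).

(** The pair [(T_n, T_(n+1))] makes the two-term recurrence structurally
    recursive. *)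
Fixpoint chebyshev_pair n : {poly R} * {poly R} :=
  if n is n'.+1 then
    let pq := chebyshev_pair n' in (pq.2, 2%:P * 'X * pq.2 - pq.1)
  else (1, 'X).

Definition chebyshev n : {poly R} := (chebyshev_pair n).1.

Lemma chebyshev_rec n :
  chebyshev n.+2 = 2%:P * 'X * chebyshev n.+1 - chebyshev n.
Proof. by []. Qed.

Lemma nat_two_step_ind (P : nat -> Prop) :
  P 0%N -> P 1%N -> (forall n, P n -> P n.+1 -> P n.+2) -> forall n, P n.
Proof.
move=> P0 P1 PS n; suff [] : P n /\ P n.+1 by [].
by elim: n => [|n [Pn Pn1]]; split=> //; apply: PS.
Qed.

Lemma chebyshev_cos n x : (chebyshev n).[cos x] = cos (n%:R * x).
Proof.
elim/nat_two_step_ind: n => [||n IHn IHn1].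
- by rewrite mul0r cos0 hornerC.
- by rewrite mul1r hornerX.
- rewrite chebyshev_rec !(hornerD, hornerN, hornerM, hornerC, hornerX) IHn IHn1.
  have -> : n.+2%:R * x = n.+1%:R * x + x by rewrite -natr1; ring.
  have -> : n%:R * x = n.+1%:R * x - x by rewrite -natr1; ring.
  by rewrite cosB cosD; ring.
Qed.

(** The hyperbolic counterpart of [chebyshev_cos]; it gives the value outside
    [[-1, 1]], where the variable is no longer a cosine. *)
Lemma chebyshev_joukowski n z : z != 0 ->
  (chebyshev n).[(z + z^-1) / 2] = (z ^+ n + z ^- n) / 2.
Proof.
move=> z0; elim/nat_two_step_ind: n => [||n IHn IHn1].
- by rewrite hornerC !expr0 invr1; field.
- by rewrite hornerX !expr1.
- rewrite chebyshev_rec !(hornerD, hornerN, hornerM, hornerC, hornerX).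
  rewrite IHn IHn1 !exprS.
  by field; rewrite z0 expf_neq0.
Qed.

Lemma norm_chebyshev_le1 n x : -1 <= x <= 1 -> `|(chebyshev n).[x]| <= 1.
Proof. by move=> x1; rewrite -(@acosK _ x) // chebyshev_cos cos_max. Qed.

Definition cheb_root T t : R := cos ((2 * t + 1)%:R / (2 * T)%:R * pi).

Lemma cos_odd_pihalf n : cos ((2 * n + 1)%:R / 2 * pi : R) = 0.
Proof.
elim: n => [|n IHn].
  by rewrite muln0 add0n mul1r mulrC cos_pihalf.
have -> : (2 * n.+1 + 1)%:R / 2 * pi = (2 * n + 1)%:R / 2 * pi + pi :> R.
  by rewrite mulnS !natrD; field.
by rewrite cosDpi IHn oppr0.
Qed.

Lemma chebyshev_root T t : (0 < T)%N -> root (chebyshev T) (cheb_root T t).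
Proof.
move=> T0; apply/eqP; rewrite chebyshev_cos -[RHS](cos_odd_pihalf t).
congr cos; rewrite natrM; field.
by rewrite pnatr_eq0 -lt0n.
Qed.

Lemma cheb_root_inj T :
  {in [pred t | (t < T)%N] &, injective (cheb_root T)}.
Proof.
move=> t1 t2 t1T t2T.
have T0 : (0 : R) < (2 * T)%:R.
  by rewrite ltr0n muln_gt0 /=; apply: leq_ltn_trans t1T.
have angle t : (t < T)%N -> (2 * t + 1)%:R / (2 * T)%:R * pi \in `[0, pi : R].
  move=> tT; rewrite in_itv /= mulr_ge0 ?divr_ge0 ?pi_ge0 //=.
  rewrite ler_piMl ?pi_ge0 // ler_pdivrMr // mul1r ler_nat.
  by rewrite addn1 ltn_pmul2l.
move=> /(cos_inj (angle _ t1T) (angle _ t2T)).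
have pi0 : (pi : R) != 0 by rewrite gt_eqF // pi_gt0.
move=> /(mulIf pi0) /(mulIf (invr_neq0 (lt0r_neq0 T0))) /eqP.
by rewrite eqr_nat eqn_add2r eqn_mul2l /= => /eqP.
Qed.

Lemma size_chebyshev_le n : (size (chebyshev n) <= n.+1)%N.
Proof.
elim/nat_two_step_ind: n => [||n IHn IHn1]; rewrite ?size_poly1 ?size_polyX //.
rewrite chebyshev_rec (leq_trans (size_polyD _ _)) // geq_max size_polyN.
rewrite (leq_trans IHn) ?andbT; last by rewrite -addn2 leq_addr.
rewrite -mulrA mul_polyC (leq_trans (size_scale_leq _ _)) //.
by rewrite (leq_trans (size_polyMleq _ _)) // size_polyX.
Qed.

(** [T] distinct zeros and degree at most [T] determine the polynomial up to its
    leading coefficient [c], which cancels in the ratio of two values. *)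
Lemma chebyshev_factor T : (0 < T)%N ->
  exists2 c : R, c != 0 &
    forall x, (chebyshev T).[x] = c * \prod_(t < T) (x - cheb_root T t).
Proof.
move=> T0; set rs := [seq cheb_root T t | t <- iota 0 T].
have T_neq0 : chebyshev T != 0.
  apply/eqP=> TE; have := chebyshev_cos T 0.
  by rewrite TE horner0 mulr0 cos0 => /eqP; rewrite eq_sym oner_eq0.
have rs_root : all (root (chebyshev T)) rs.
  by apply/allP=> _ /mapP[t _ ->]; apply: chebyshev_root.
have rs_uniq : uniq rs.
  rewrite map_inj_in_uniq ?iota_uniq // => t1 t2.
  by rewrite !mem_iota /= !add0n => t1T t2T; apply: cheb_root_inj.
have rs_size : size rs = T by rewrite size_map size_iota.
have szT : size (chebyshev T) = (size rs).+1.
  apply/eqP; rewrite eqn_leq {1}rs_size size_chebyshev_le /=.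
  exact: max_poly_roots.
exists (lead_coef (chebyshev T)); first by rewrite lead_coef_eq0.
move=> x; rewrite {1}(all_roots_prod_XsubC szT) ?uniq_rootsE //.
rewrite hornerZ horner_prod big_map.
rewrite -(big_mkord xpredT (fun t => x - cheb_root T t)) /index_iota subn0.
by congr (_ * _); apply: eq_bigr => t _; rewrite !hornerE.
Qed.

End Chebyshev.

(** * The convergence rate *)

Section Rate.
Context {R : realType}.
Implicit Types (m M kappa : R) (T : nat).

Lemma chebyshev_node_ge m M T t : m <= M -> m <= chebyshev_node m M T t.
Proof.
move=> mM; rewrite /chebyshev_node.
have := cos_geN1 ((2 * t + 1)%:R / (2 * T)%:R * pi : R).
set c := cos _ => c_ge.
have : 0 <= (M - m) * (c + 1) by apply: mulr_ge0; lra.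
lra.
Qed.

Lemma slingshot_rate_ge0 kappa T : 1 <= kappa -> 0 <= slingshot_rate kappa T.
Proof.
move=> k1; have q1 : 1 <= Num.sqrt kappa by rewrite -sqrtr1 ler_wsqrtr.
have qD : 0 <= Num.sqrt kappa + 1 by lra.
have qB : 0 <= Num.sqrt kappa - 1 by lra.
by rewrite /slingshot_rate divr_ge0 ?addr_ge0 ?mulr_ge0 ?exprn_ge0.
Qed.

(** For [m < M] the product is the ratio [T_T(x) / T_T(x0)] of two values of the
    Chebyshev polynomial, whose absolute values are at most 1 for the first and
    exactly [1 / R_T] for the second. *)
Lemma slingshot_poly_bound m M T l : 0 < m -> (0 < T)%N -> m <= l <= M ->
  `|\prod_(t < T) (1 - l / chebyshev_node m M T t)| <= slingshot_rate (M / m) T.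
Proof.
move=> m0 T0 /andP[ml lM]; have mM := le_trans ml lM.
have k1 : 1 <= M / m by rewrite ler_pdivlMr // mul1r.
move: mM; rewrite le_eqVlt => /predU1P[mM | mM].
  (* The rescaling to [[-1, 1]] degenerates when [m = M], but then every node is
     [m], the only possible [l], and already the first factor vanishes. *)
  have ->: l = m by apply/eqP; rewrite eq_le ml mM lM.
  have -> : \prod_(t < T) (1 - m / chebyshev_node m M T t) = 0.
    rewrite (bigD1 (Ordinal T0)) //= /chebyshev_node -mM subrr !mul0r addr0.
    rewrite -mulr2n -[m *+ 2]mulr_natr mulfK // divff ?subrr ?mul0r //.
    by rewrite gt_eqF.
  by rewrite normr0 slingshot_rate_ge0.
have d0 : 0 < M - m by rewrite subr_gt0.
(* [x] and [x0] are the images of [l] and [0] under the affine map that takes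
   [[m, M]] to [[-1, 1]]. *)
pose x : R := (2 * l - (M + m)) / (M - m); pose x0 : R := - (M + m) / (M - m).
have [c c0 TE] := @chebyshev_factor R _ T0.
have node0 t : chebyshev_node m M T t != 0.
  by rewrite gt_eqF // (lt_le_trans m0) // chebyshev_node_ge // ltW.
have nodeE t : chebyshev_node m M T t = (M - m) / 2 * (cheb_root T t - x0).
  by rewrite /chebyshev_node -/(cheb_root T t) /x0; field; rewrite gt_eqF.
have factorE t : 1 - l / chebyshev_node m M T t =
    (x - cheb_root T t) / (x0 - cheb_root T t).
  have := node0 t; rewrite nodeE => nz.
  have nz' : x0 - cheb_root T t != 0.
    by apply: contra_neq nz => e; rewrite -(opprB x0) e oppr0 mulr0.
  have -> : x = x0 + 2 * l / (M - m) by rewrite /x /x0; field; rewrite gt_eqF.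
  field; rewrite nz' (gt_eqF d0) /=.
  by rewrite -(opprB x0) oppr_eq0.
under eq_bigr do rewrite factorE.
rewrite big_split /= prodfV.
have -> : (\prod_(t < T) (x - cheb_root T t)) /
      (\prod_(t < T) (x0 - cheb_root T t)) = (chebyshev T).[x] / (chebyshev T).[x0].
  by rewrite !TE -mulf_div (divff c0) mul1r.
pose q : R := Num.sqrt (M / m); pose a : R := (q + 1) / (q - 1).
have q1 : 1 < q.
  rewrite -sqrtr1 /q ltr_sqrt; first by rewrite ltr_pdivlMr ?mul1r.
  by rewrite divr_gt0 //; lra.
have qM : M = q ^+ 2 * m.
  by rewrite sqr_sqrtr ?divr_ge0 ?ltW // ?divfK ?gt_eqF //; lra.
have qB : 0 < q - 1 by lra.
have qD : 0 < q + 1 by lra.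
have a0 : 0 < a by rewrite divr_gt0.
have aT0 : 0 < a ^+ T by rewrite exprn_gt0.
have x0E : x0 = (- a + (- a)^-1) / 2.
  rewrite /x0 /a qM; field.
  by rewrite !gt_eqF //=; nra.
have Tx0 : `|(chebyshev T).[x0]| = (a ^+ T + a ^- T) / 2.
  rewrite x0E chebyshev_joukowski ?oppr_eq0 ?gt_eqF //.
  rewrite exprNn invfM invr_sign -mulrDr -mulrA normrM normr_sign mul1r.
  by rewrite ger0_norm // divr_ge0 // addr_ge0 // ?invr_ge0 ltW.
have rateE : slingshot_rate (M / m) T = 1 / ((a ^+ T + a ^- T) / 2).
  rewrite /slingshot_rate -/q /a !(mulnC 2) !exprM expr_div_n.
  have := exprn_gt0 T qB; have := exprn_gt0 T qD.
  set A := _ ^+ T; set B := _ ^+ T => A0 B0.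
  field; rewrite !gt_eqF //=; nra.
rewrite normrM normfV Tx0 rateE ler_pM2r; last first.
  by rewrite invr_gt0 divr_gt0 // addr_gt0 // invr_gt0.
apply: norm_chebyshev_le1.
by rewrite ler_pdivlMr // ler_pdivrMr //; lra.
Qed.

(** With [q] the square root of [kappa], the rate is at most
    [2 ((q - 1) / (q + 1))^T], by dropping the second summand of its denominator,
    and [(q - 1) / (q + 1) <= 1 - 1 / q <= exp (- 1 / q)] as [q >= 1]. *)
Lemma slingshot_rate_le_expR kappa T : 1 <= kappa ->
  slingshot_rate kappa T <= 2 * expR (- (T%:R / Num.sqrt kappa)).
Proof.
move=> k1; rewrite /slingshot_rate; set q := Num.sqrt kappa.
have q1 : 1 <= q by rewrite -sqrtr1 ler_wsqrtr.
have qD : 0 < q + 1 by lra.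
have qB : 0 <= q - 1 by lra.
have DT := exprn_gt0 T qD; have BT := exprn_ge0 T qB.
apply: (@le_trans _ _ (2 * ((q - 1) / (q + 1)) ^+ T)).
  rewrite !(mulnC 2) !exprM expr_div_n.
  move: DT BT; set A := _ ^+ T; set B := _ ^+ T => A0 B0.
  rewrite ler_pdivrMr; last by nra.
  rewrite -subr_ge0.
  have -> : 2 * (B / A) * (A ^+ 2 + B ^+ 2) - 2 * A * B = 2 * B ^+ 3 / A.
    by field; rewrite gt_eqF.
  by rewrite divr_ge0 ?mulr_ge0 ?exprn_ge0 // ltW.
rewrite ler_pM2l // -mulrN expRM_natl.
rewrite lerXn2r ?nnegrE ?expR_ge0 ?divr_ge0 ?(ltW qD) //.
apply: le_trans (expR_ge1Dx _).
rewrite ler_pdivrMr // -subr_ge0.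
have -> : (1 - q^-1) * (q + 1) - (q - 1) = (q - 1) / q.
  by field; rewrite gt_eqF //; lra.
by rewrite divr_ge0 //; lra.
Qed.

End Rate.

(** * Polynomials of a symmetric matrix *)

(** The only use of the spectral theorem: [A] is diagonalized over [R[i]] by a
    unitary [P], so that the form is [\sum_i g(d_i) |(P w)_i|^2].  The [d_i] are
    real because [A] is Hermitian, hence they are eigenvalues of [A] over [R]. *)
Lemma horner_mx_quad_ge0 (R : rcfType) n (A : 'M[R]_n.+1) (g : {poly R})
    (w : 'cV[R]_n.+1) :
  A^T = A -> (forall l, eigenvalue A l -> 0 <= g.[l]) ->
  0 <= (w^T *m horner_mx A g *m w) 0 0.
Proof.
move=> Asym g_ge0; pose toC := real_complex R.
pose A' := map_mx toC A.
have conj_toC k l (N : 'M[R]_(k, l)) :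
    map_mx Num.conj (map_mx toC N) = map_mx toC N.
  apply/matrixP=> i j; rewrite !mxE; apply: conj_Creal.
  by apply/complex_realP; exists (N i j).
have A'herm : A' \is hermsymmx.
  by rewrite is_hermitianmxE expr0 scale1r /A' map_trmx conj_toC Asym.
have A'E := orthomx_spectralP (hermitian_normalmx A'herm).
set P := spectralmx A' in A'E; set d := spectral_diag A' in A'E.
have Punit : P \is a GRing.unit := spectral_unit A'.
have dE i : exists2 l : R, d 0 i = toC l & eigenvalue A l.
  have /complex_realP[l dl] : d 0 i \is Num.real.
    exact: (mxOverP (hermitian_spectral_diag_real A'herm)).
  exists l => //; rewrite -(eigenvalue_map toC).
  have -> : eigenvalue (map_mx toC A) (toC l) = eigenvalue A' (d 0 i).
    by rewrite dl.
  apply/eigenvalueP; exists (row i P).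
    rewrite -row_mul -/A' A'E !mulmxA mulmxV // mul1mx.
    by apply/rowP=> j; rewrite mxE mul_diag_mx !mxE.
  apply/eqP=> Pi0; have := row_free_unit P.
  rewrite (Punit : P \in unitmx) => /row_freeP[Q PQ].
  have /rowP/(_ i) := congr1 (row i) PQ.
  by rewrite row_mul Pi0 mul0mx !mxE eqxx => /eqP; rewrite eq_sym oner_eq0.
pose c := P *m map_mx toC w.
have -> : (0 <= (w^T *m horner_mx A g *m w) 0 0) =
    (0 <= map_mx toC (w^T *m horner_mx A g *m w) 0 0).
  by rewrite [in RHS]mxE; symmetry; exact: ler0c.
rewrite !map_mxM map_horner_mx -/A' A'E horner_mx_uconjC // horner_mx_diag.
have PE : invmx P = map_mx Num.conj P^T.
  by rewrite invmx_unitary // spectral_unitarymx.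
set gd := diag_mx _.
have -> : map_mx toC w^T *m (invmx P *m gd *m P) *m map_mx toC w =
    map_mx Num.conj c^T *m (gd *m c).
  by rewrite PE trmx_mul map_mxM map_trmx conj_toC !mulmxA.
rewrite mxE sumr_ge0 // => i _; rewrite mul_diag_mx !mxE.
have [l -> /g_ge0 gl] := dE i.
rewrite horner_map mulrCA mulr_ge0 //; first by rewrite -[0]/(toC 0) lecR.
by rewrite mulrC; apply: mul_conjC_ge0.
Qed.

Section SquaredNorm.
Context {R : realType}.

Definition sqnorm n (u : 'cV[R]_n) : R := \sum_i u i 0 ^+ 2.

Lemma sqnormE n (u : 'cV[R]_n) : sqnorm u = (u^T *m u) 0 0.
Proof. by rewrite mxE; apply: eq_bigr => i _; rewrite mxE expr2. Qed.

Lemma sqnorm_ge0 n (u : 'cV[R]_n) : 0 <= sqnorm u.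
Proof. by apply: sumr_ge0 => i _; apply: sqr_ge0. Qed.

Lemma sqnorm_eq0 n (u : 'cV[R]_n) : sqnorm u = 0 -> u = 0.
Proof.
move=> /psumr_eq0P u0; apply/colP => i; rewrite mxE.
by apply/eqP; rewrite -sqrf_eq0; apply/eqP/u0 => // j _; apply: sqr_ge0.
Qed.

(** Solvability of the normal equations [B^T B w = B^T u], since [B^T B] has the
    row space of [B]: a vector of the form [D B^T] that [B] annihilates is
    orthogonal to itself. *)
Lemma kernel_range_decomposition k n (B : 'M[R]_(k, n)) (u : 'cV[R]_k) :
  exists us w, B^T *m us = 0 /\ u = us + B *m w.
Proof.
have capB0 : (B^T :&: kermx B)%MS = 0.
  apply/eqP; rewrite -submx0; apply/rV_subP => v.
  rewrite sub_capmx => /andP[/submxP[D vE] /sub_kermxP vB].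
  suff -> : v = 0 by rewrite sub0mx.
  rewrite -[v]trmxK (@sqnorm_eq0 _ v^T) ?trmx0 //.
  by rewrite sqnormE trmxK {2}vE trmx_mul trmxK mulmxA vB mul0mx mxE.
have rankE : \rank (B^T *m B) = \rank B.
  by rewrite -[RHS]mxrank_tr -(mxrank_mul_ker B^T B) capB0 mxrank0 addn0.
have /submxP[D DE] : (u^T *m B <= B^T *m B)%MS.
  have /eqmxP/eqmx_sym BE : (B^T *m B == B)%MS.
    by rewrite -(geq_leqif (mxrank_leqif_eq (submxMl _ _))) rankE.
  by rewrite -BE submxMl.
exists (u - B *m D^T), D^T; split; last by rewrite subrK.
apply: trmx_inj; rewrite trmx0 trmx_mul trmxK linearB /= mulmxBl DE.
by rewrite trmx_mul trmxK mulmxA subrr.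
Qed.

Lemma eigenvalue_tr_mul_self_ge0 k n (B : 'M[R]_(k, n)) l :
  eigenvalue (B^T *m B) l -> 0 <= l.
Proof.
case/eigenvalueP => v vE v0.
have : 0 <= l * sqnorm v^T.
  have -> : l * sqnorm v^T = sqnorm (B *m v^T).
    rewrite !sqnormE trmxK trmx_mul trmxK -mulmxA (mulmxA B^T) mulmxA.
    by rewrite vE -scalemxAl [RHS]mxE.
  exact: sqnorm_ge0.
rewrite pmulr_lge0 // lt_neqAle sqnorm_ge0 andbT eq_sym.
by apply: contra_neq v0 => /sqnorm_eq0 e; rewrite -[v]trmxK e trmx0.
Qed.

(** If [v] is an eigenvector of [B B^T], then [v B] is one of [B^T B]. Thus a
    spectral hypothesis on [B^T B] serves both players. *)
Lemma eigenvalue_mul_tr k n (B : 'M[R]_(k, n)) l :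
  l != 0 -> eigenvalue (B *m B^T) l -> eigenvalue (B^T *m B) l.
Proof.
move=> l0 /eigenvalueP[v vE v0]; apply/eigenvalueP; exists (v *m B).
  by rewrite mulmxA -(mulmxA v) vE scalemxAl.
apply: contra_neq v0 => vB0; move: vE; rewrite mulmxA vB0 mul0mx => /esym/eqP.
by rewrite scaler_eq0 (negPf l0) => /eqP.
Qed.

Lemma trmx_horner n (A : 'M[R]_n.+1) p : (horner_mx A p)^T = horner_mx A^T p.
Proof.
elim/poly_ind: p => [|p c IHp]; first by rewrite !rmorph0 trmx0.
rewrite !rmorphD !rmorphM /= !horner_mx_X !horner_mx_C linearD /= tr_scalar_mx.
rewrite -[_ * A]/(_ *m A) trmx_mul IHp; congr (_ + _).
by have := comm_horner_mx2 A^T 'X p; rewrite horner_mx_X.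
Qed.

(** The difference of the two sides is the quadratic form at [w] of [g(B^T B)],
    where [g(X) = X (rho^2 - p(X)^2)].  The factor [X] makes [g] vanish at 0,
    which is why bounding [p] at the nonzero eigenvalues is enough. *)
Lemma sqnorm_horner_le k n (B : 'M[R]_(k, n.+1)) (p : {poly R}) (rho : R)
    (w : 'cV[R]_n.+1) :
  (forall l : R, l != 0 -> eigenvalue (B^T *m B) l -> `|p.[l]| <= rho) ->
  sqnorm (B *m horner_mx (B^T *m B) p *m w) <= rho ^+ 2 * sqnorm (B *m w).
Proof.
move=> p_le; set A := B^T *m B.
have Asym : A^T = A by rewrite trmx_mul trmxK.
pose g : {poly R} := (rho ^+ 2)%:P * 'X - p * 'X * p.
rewrite -subr_ge0.
have -> : rho ^+ 2 * sqnorm (B *m w) - sqnorm (B *m horner_mx A p *m w) =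
    (w^T *m horner_mx A g *m w) 0 0.
  rewrite rmorphB rmorphM (rmorphM _ (p * 'X) p) (rmorphM _ p 'X) /=.
  rewrite horner_mx_X horner_mx_C.
  rewrite -!mulmxE mul_scalar_mx mulmxBr mulmxBl.
  rewrite [in RHS]mxE [X in _ = _ + X]mxE -scalemxAr -scalemxAl [in RHS]mxE.
  rewrite !sqnormE !trmx_mul trmx_horner Asym /A !mulmxA.
  by [].
apply: horner_mx_quad_ge0 => // l lA.
rewrite /g !hornerE.
have [->|l0] := eqVneq l 0; first by rewrite !(mulr0, mul0r) subrr.
have -> : rho ^+ 2 * l - p.[l] * l * p.[l] = l * (rho ^+ 2 - `|p.[l]| ^+ 2).
  by rewrite real_normK ?num_real //; ring.
rewrite mulr_ge0 ?(eigenvalue_tr_mul_self_ge0 lA) // subr_ge0.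
by rewrite lerXn2r ?nnegrE ?(le_trans (normr_ge0 _) (p_le _ l0 lA)) // p_le.
Qed.

(** The component [us] in the kernel of [B^T] is fixed, and [B] intertwines
    [B B^T] with [B^T B], so the rest of [u t] is [B p_t(B^T B) w] with [p_t] the
    product of the first [t] factors. *)
Lemma richardson_bound k n (B : 'M[R]_(k, n.+1)) (c : nat -> R)
    (u : nat -> 'cV[R]_k) us w T rho :
  B^T *m us = 0 -> u 0%N = us + B *m w ->
  (forall t, (t < T)%N -> u t.+1 = u t - c t *: (B *m (B^T *m u t))) ->
  (forall l : R, l != 0 -> eigenvalue (B^T *m B) l ->
     `|\prod_(t < T) (1 - c t * l)| <= rho) ->
  sqnorm (u T - us) <= rho ^+ 2 * sqnorm (u 0%N - us).
Proof.
move=> us0 u0 uS rho_ge; set A := B^T *m B.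
pose p j : {poly R} := \prod_(t < j) (1 - c t *: 'X).
have uE j : (j <= T)%N -> u j = us + B *m horner_mx A (p j) *m w.
  elim: j => [_|j IHj jT]; first by rewrite u0 /p big_ord0 rmorph1 mulmx1.
  rewrite uS // IHj ?(ltnW jT) // /p big_ord_recr /= -/(p j) mulrC rmorphM /=.
  rewrite rmorphB rmorph1 -mul_polyC rmorphM /= horner_mx_C horner_mx_X.
  rewrite -!mulmxE mul_scalar_mx mulmxBl mul1mx mulmxBr mulmxBl addrA.
  congr (_ - _); rewrite mulmxDr us0 add0r -scalemxAl -scalemxAr -scalemxAl.
  by congr (_ *: _); rewrite !mulmxA.
rewrite uE // u0 ![us + _]addrC !addrK.
apply: sqnorm_horner_le => l l0 lA.
rewrite horner_prod; under eq_bigr do rewrite !hornerE.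
exact: rho_ge.
Qed.

End SquaredNorm.

(** * Gradient descent ascent on a bilinear objective *)

Section Dynamics.
Context {R : realType}.

Lemma gradient_affine n (c x0 x : 'cV[R]_n) :
  gradient (fun x => (c^T *m (x - x0)) 0 0) x = c.
Proof.
apply/colP => i; rewrite mxE /derive.
apply: norm_lim_near_cst.
near=> h.
have h0 : h != 0 by near: h; exact: nbhs_dnbhs_neq.
rewrite /= -addrA mulmxDr [X in X - _]mxE addrK.
rewrite -scalemxAr mxE scalerA mulVf // scale1r.
rewrite mxE (bigD1 i) //= !mxE !eqxx mulr1 big1 ?addr0 // => j /negPf ji.
by rewrite !mxE ji mulr0.
Unshelve. all: by end_near.
Qed.

Variables (dx dy : nat) (B : 'M[R]_(dx, dy)) (xt : 'cV[R]_dx) (yt : 'cV[R]_dy).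
Let f := bilinear_objective B xt yt.

Lemma gradient_bilinear_l x y : gradient (fun x => f x y) x = B *m (y - yt).
Proof.
rewrite -[RHS](gradient_affine (B *m (y - yt)) xt x).
congr gradient; apply/funext => u; rewrite /f /bilinear_objective.
have tr1 (X : 'M[R]_1) : X^T 0 0 = X 0 0 by rewrite mxE.
by rewrite -[LHS]tr1 -mulmxA trmx_mul trmxK.
Qed.

Lemma gradient_bilinear_r x y : gradient (fun y => f x y) y = B^T *m (x - xt).
Proof.
rewrite -[RHS](gradient_affine (B^T *m (x - xt)) yt y).
by congr gradient; apply/funext => v; rewrite trmx_mul trmxK.
Qed.

(** The terms of first order in [h] of the two half-steps cancel, which leaves a
    step of length [h^2] that no longer couples the two players. *)
Lemma gda_two_steps alpha beta z0 k h :
    alpha (2 * k)%N = h -> beta (2 * k)%N = - h ->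
    alpha (2 * k + 1)%N = - h -> beta (2 * k + 1)%N = h ->
  let z := gda f alpha beta z0 (2 * k) in
  let z' := gda f alpha beta z0 (2 * k.+1) in
  z'.1 - xt = z.1 - xt - h ^+ 2 *: (B *m (B^T *m (z.1 - xt))) /\
  z'.2 - yt = z.2 - yt - h ^+ 2 *: (B^T *m (B *m (z.2 - yt))).
Proof.
rewrite addn1 => a0 b0 a1 b1 z z'.
have zE : z' =
    (z.1 - h *: (B *m (z.2 - yt))
       + h *: (B *m (z.2 - h *: (B^T *m (z.1 - xt)) - yt)),
     z.2 - h *: (B^T *m (z.1 - xt))
       + h *: (B^T *m (z.1 - h *: (B *m (z.2 - yt)) - xt))).
  rewrite /z' mulnS add2n /= -/z a0 b0 a1 b1.
  by rewrite !gradient_bilinear_l !gradient_bilinear_r !scaleNr !opprK.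
rewrite zE /=; split.
  rewrite [z.2 - _ - yt]addrAC; set u := z.1 - xt; set v := z.2 - yt.
  rewrite (mulmxBr B v) scalerBr -scalemxAr scalerA -expr2.
  by rewrite addrA subrK addrAC.
rewrite [z.1 - _ - xt]addrAC; set u := z.1 - xt; set v := z.2 - yt.
rewrite (mulmxBr _ u) scalerBr -scalemxAr scalerA -expr2.
by rewrite addrA subrK addrAC.
Qed.

Lemma saddle_point_kernel us vs : B^T *m us = 0 -> B *m vs = 0 ->
  saddle_point f (us + xt, vs + yt).
Proof.
move=> Bus Bvs x y; rewrite /f /bilinear_objective /= !addrK.
have usB : us^T *m B = 0 by rewrite -[B]trmxK -trmx_mul Bus trmx0.
by rewrite usB -mulmxA Bvs !mul0mx mulmx0 !mxE lexx.
Qed.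

End Dynamics.

(** * Contraction along a slingshot schedule *)

(** The polynomial of the scheme is a product over the whole schedule, so the
    permutation of the steps does not affect it. *)
Lemma slingshot_richardson_bound (R : realType) k n (B : 'M[R]_(k, n.+1))
    (m M : R) T alpha beta (u : nat -> 'cV[R]_k) us w :
  0 < m -> m <= M -> (0 < T)%N -> slingshot m M T alpha beta ->
  (forall l : R, l != 0 -> eigenvalue (B^T *m B) l -> m <= l <= M) ->
  B^T *m us = 0 -> u 0%N = us + B *m w ->
  (forall t, (t < T)%N ->
     u t.+1 = u t - alpha (2 * t)%N ^+ 2 *: (B *m (B^T *m u t))) ->
  sqnorm (u T - us) <= slingshot_rate (M / m) T ^+ 2 * sqnorm (u 0%N - us).
Proof.
move=> m0 mM T0 [s steps] eigB us0 u0 uS.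
apply: (richardson_bound us0 u0 uS) => l l0 lB.
have -> : \prod_(t < T) (1 - alpha (2 * t)%N ^+ 2 * l) =
    \prod_(t < T) (1 - l / chebyshev_node m M T t).
  rewrite [RHS](reindex_inj (@perm_inj _ s)); apply: eq_bigr => t _.
  have [-> _ _ _] := steps t.
  rewrite exprVn sqr_sqrtr 1?mulrC //.
  exact/ltW/(lt_le_trans m0)/chebyshev_node_ge.
exact: slingshot_poly_bound m0 T0 (eigB l l0 lB).
Qed.

Lemma enormE (R : realType) dx dy (z : 'cV[R]_dx * 'cV[R]_dy) :
  enorm z = Num.sqrt (sqnorm z.1 + sqnorm z.2).
Proof. by []. Qed.

Lemma slingshot_gda_bound (R : realType) dx dy (B : 'M[R]_(dx.+1, dy.+1))
    (xt us : 'cV[R]_dx.+1) (yt vs : 'cV[R]_dy.+1) wx wy z0 (m M : R) T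
    (alpha beta : nat -> R) :
  0 < m -> m <= M -> (0 < T)%N -> slingshot m M T alpha beta ->
  (forall l : R, l != 0 -> eigenvalue (B^T *m B) l -> m <= l <= M) ->
  B^T *m us = 0 -> B *m vs = 0 ->
  z0.1 - xt = us + B *m wx -> z0.2 - yt = vs + B^T *m wy ->
  enorm (gda (bilinear_objective B xt yt) alpha beta z0 (2 * T)
           - (us + xt, vs + yt))
    <= slingshot_rate (M / m) T * enorm (z0 - (us + xt, vs + yt)).
Proof.
move=> m0 mM T0 sl eigB us0 vs0 z01 z02.
pose z t := gda (bilinear_objective B xt yt) alpha beta z0 (2 * t).
have two_steps t : (t < T)%N ->
    (z t.+1).1 - xt = (z t).1 - xt
      - alpha (2 * t)%N ^+ 2 *: (B *m (B^T *m ((z t).1 - xt))) /\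
    (z t.+1).2 - yt = (z t).2 - yt
      - alpha (2 * t)%N ^+ 2 *: (B^T *m (B *m ((z t).2 - yt))).
  move=> tT; have [s /(_ (Ordinal tT)) /= [ea eb ea1 eb1]] := sl.
  by apply: gda_two_steps; rewrite ?ea.
have rate0 : 0 <= slingshot_rate (M / m) T.
  by rewrite slingshot_rate_ge0 // ler_pdivlMr // mul1r.
have ux := @slingshot_richardson_bound _ _ _ B _ _ _ _ _ (fun t => (z t).1 - xt)
  us wx m0 mM T0 sl eigB us0 z01 (fun t tT => (two_steps t tT).1).
have eigBT (l : R) : l != 0 -> eigenvalue (B^T^T *m B^T) l -> m <= l <= M.
  by move=> l0; rewrite trmxK => /(eigenvalue_mul_tr l0); apply: eigB.
have uy : sqnorm ((z T).2 - yt - vs) <= slingshot_rate (M / m) T ^+ 2 *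
    sqnorm ((z 0%N).2 - yt - vs).
  apply: (@slingshot_richardson_bound _ _ _ B^T _ _ _ _ _ (fun t => (z t).2 - yt)
    vs wy m0 mM T0 sl eigBT); rewrite ?trmxK // => t tT.
  exact: (two_steps t tT).2.
rewrite !enormE -[X in X * _](ger0_norm rate0) -sqrtr_sqr -sqrtrM ?sqr_ge0 //.
apply: ler_wsqrtr; rewrite mulrDr /=.
rewrite -/(z T) !(addrC us, addrC vs) !opprD !addrA; exact: lerD.
Qed.

(** By [slingshot_rate_le_expR], [T >= 2 q ln (D / eps)] suffices: the bound
    becomes [2 (eps / D)^2 D <= eps].  Rounding up costs 2 in [2 T0], which is
    absorbed by [2 / ln 2] because [q ln (D / eps) >= ln 2].  Both estimates use
    [eps <= D / 2]. *)
Lemma slingshot_iteration_count (R : realType) (m M D eps : R) :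
  0 < m -> m <= M -> 0 < eps -> eps <= D / 2 ->
  let q := Num.sqrt (M / m) in
  exists T0 : nat,
  [/\ (0 < T0)%N,
      (2 * T0)%:R <= (4 + 2 / ln 2) * (q * ln (D / eps))
    & forall T, (T0 <= T)%N -> slingshot_rate (M / m) T * D <= eps].
Proof.
move=> m0 mM eps0 epsD q.
have k1 : 1 <= M / m by rewrite ler_pdivlMr // mul1r.
have q1 : 1 <= q by rewrite -sqrtr1 ler_wsqrtr.
have D0 : 0 < D by lra.
have ln2 : 0 < ln 2 :> R by rewrite ln_gt0 // ltr1n.
set L := ln (D / eps).
have ln2L : ln 2 <= L.
  by rewrite ler_ln ?posrE ?divr_gt0 // ler_pdivlMr //; lra.
have qL0 : 0 < q * L by rewrite mulr_gt0 //; lra.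
exists (Num.trunc (2 * (q * L))).+1; split=> //.
  have tr : (Num.trunc (2 * (q * L)))%:R <= 2 * (q * L).
    by rewrite truncn_le; lra.
  rewrite natrM -natr1.
  have : 2 <= 2 / ln 2 * (q * L).
    rewrite -mulrA ler_peMr // mulrC ler_pdivlMr // mul1r.
    by rewrite -[ln 2]mul1r ler_pM //; lra.
  by lra.
move=> T T0T.
have TqL : 2 * (q * L) <= T%:R.
  by apply/ltW/(lt_le_trans (truncnS_gt _)); rewrite ler_nat.
apply: (@le_trans _ _ (2 * expR (- (T%:R / q)) * D)).
  by rewrite ler_pM2r // slingshot_rate_le_expR.
have : expR (- (T%:R / q)) <= expR (- (2 * L)).
  by rewrite ler_expR lerN2 ler_pdivlMr; lra.
have -> : expR (- (2 * L)) = (eps / D) ^+ 2.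
  by rewrite -mulrN expRM_natl expRN lnK ?posrE ?divr_gt0 // invf_div.
set E := expR _ => Ele.
apply: (@le_trans _ _ (2 * (eps / D) ^+ 2 * D)).
  by rewrite ler_pM2r // ler_pM2l.
have -> : 2 * (eps / D) ^+ 2 * D = eps * (2 * eps / D) by field; lra.
by apply: ler_piMr; [exact: ltW | rewrite ler_pdivrMr //; lra].
Qed.

Theorem theorem3p3 (R : realType) :
  exists2 C : R, 0 < C &
  forall (dx dy : nat) (z0 : 'cV[R]_dx * 'cV[R]_dy) (m M : R)
    (xt : 'cV[R]_dx) (yt : 'cV[R]_dy) (B : 'M[R]_(dx, dy)),
  (0 < dx)%N -> (0 < dy)%N -> 0 < m -> m <= M ->
  (forall s : R, singular_value B s -> s ^+ 2 != 0 -> m <= s ^+ 2 <= M) ->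
  let kappa := M / m in
  let f := bilinear_objective B xt yt in
  exists zs : 'cV[R]_dx * 'cV[R]_dy,
  [/\ saddle_point f zs,
      forall (T : nat) (alpha beta : nat -> R), (0 < T)%N ->
        slingshot m M T alpha beta ->
        enorm (gda f alpha beta z0 (2 * T) - zs)
          <= slingshot_rate kappa T * enorm (z0 - zs)
    & forall eps : R, 0 < eps -> eps <= enorm (z0 - zs) / 2 ->
        exists T0 : nat,
        [/\ (0 < T0)%N,
            (2 * T0)%:R <= C * (Num.sqrt kappa * ln (enorm (z0 - zs) / eps))
          & forall (T : nat) (alpha beta : nat -> R), (T0 <= T)%N ->
              slingshot m M T alpha beta ->
              enorm (gda f alpha beta z0 (2 * T) - zs) <= eps]].
Proof.
exists (4 + 2 / ln 2).
  by rewrite addr_gt0 // divr_gt0 // ln_gt0 // ltr1n.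
move=> [//|dx] [//|dy] z0 m M xt yt B _ _ m0 mM svB kappa f.
have eigB (l : R) : l != 0 -> eigenvalue (B^T *m B) l -> m <= l <= M.
  move=> l0 lB; have l_ge0 := eigenvalue_tr_mul_self_ge0 lB.
  have := svB (Num.sqrt l); rewrite sqr_sqrtr //; apply=> //.
  by split; [exact: sqrtr_ge0 | rewrite sqr_sqrtr].
have [us [wx [us0 z01]]] := kernel_range_decomposition B (z0.1 - xt).
have [vs [wy [vs0 z02]]] := kernel_range_decomposition B^T (z0.2 - yt).
rewrite trmxK in vs0.
have rate := fun T alpha beta T0 sl =>
  @slingshot_gda_bound _ _ _ B xt us yt vs wx wy z0 m M T alpha beta
    m0 mM T0 sl eigB us0 vs0 z01 z02.
exists (us + xt, vs + yt); split=> //; first exact: saddle_point_kernel.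
move=> eps eps0 epsD.
have [T0 [T0_gt0 T0_le T0_rate]] := slingshot_iteration_count m0 mM eps0 epsD.
exists T0; split=> // T alpha beta T0T sl.
by apply: le_trans (T0_rate T T0T); apply: rate => //; apply: leq_trans T0T.
Qed.
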